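(* Let $G$ be a bounded metric operator on $\mathcal H$ and $S$ a closed densely defined operator in $\mathcal H$. Define $K$ on $D(K)=G^{1/2}D(S)$ by $K\xi=G^{1/2}SG^{-1/2}\xi$. Then $K$ is densely defined and $K^*=G^{-1/2}S^*G^{1/2}$, where the latter operator has its natural domain $\{\eta\in\mathcal H: G^{1/2}\eta\in D(S^* ),\ S^*G^{1/2}\eta\in D(G^{-1/2})\}$.
   Context: A metric operator on a Hilbert space $\mathcal H$ is a self-adjoint operator $G$ with $\langle G\xi,\xi\rangle>0$ for all nonzero $\xi\in D(G)$; $G^{-1/2}$ denotes the (possibly unbounded) inverse of $G^{1/2}$, with domain the range of $G^{1/2}$. $S^*$ denotes the Hilbert space adjoint in $\mathcal H$. *)

(* Defs.v *)
(* Complex Hilbert spaces are not available in the installed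
   libraries, so they are axiomatised here (as hypotheses, i.e. Props) over a
   numeric closed field C whose real part is Dedekind complete (so C is the
   field of complex numbers). *)
From HB Require Import structures.
From mathcomp Require Import all_boot all_order all_algebra.
From Stdlib Require Import ClassicalEpsilon.
Set Implicit Arguments. Unset Strict Implicit. Unset Printing Implicit Defensive.
Import Order.TTheory GRing.Theory Num.Theory.
Local Open Scope ring_scope.

Definition C_complete (C : numClosedFieldType) : Prop :=
  forall A : C -> Prop,
    (forall x, A x -> x \is Num.real) -> (exists x, A x) ->
    (exists M, forall x, A x -> x <= M) ->
    exists s, (forall x, A x -> x <= s) /\
              (forall M, (forall x, A x -> x <= M) -> s <= M).

Section Hilbert.
Variables (C : numClosedFieldType) (H : lmodType C) (ip : H -> H -> C).

Record inner_product : Prop := {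
  ip_linl : forall a x y z, ip (a *: x + y) z = a * ip x z + ip y z;
  ip_conj : forall x y, ip y x = (ip x y)^*;
  ip_pos  : forall x, 0 <= ip x x;
  ip_def  : forall x, ip x x = 0 -> x = 0 }.

Definition hnorm (x : H) : C := sqrtC (ip x x).

Definition converges (u : nat -> H) (l : H) : Prop :=
  forall e : C, 0 < e -> exists N, forall n, (N <= n)%N -> hnorm (u n - l) < e.

Definition cauchy (u : nat -> H) : Prop :=
  forall e : C, 0 < e -> exists N, forall n m, (N <= n)%N -> (N <= m)%N ->
    hnorm (u n - u m) < e.

Definition complete : Prop := forall u, cauchy u -> exists l, converges u l.

Definition hilbert : Prop := C_complete C /\ inner_product /\ complete.

Definition dense (D : H -> Prop) : Prop :=
  forall x (e : C), 0 < e -> exists y, D y /\ hnorm (x - y) < e.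

Record op := mkOp { dom : H -> Prop; app : H -> H }.

Definition linear_op (T : op) : Prop :=
  dom T 0 /\
  forall a x y, dom T x -> dom T y ->
    dom T (a *: x + y) /\ app T (a *: x + y) = a *: app T x + app T y.

Definition densely_defined (T : op) : Prop := dense (dom T).

Definition closed_op (T : op) : Prop :=
  forall (u : nat -> H) l m, (forall n, dom T (u n)) -> converges u l ->
    converges (fun n => app T (u n)) m -> dom T l /\ app T l = m.

Definition adjoint (T : op) : op :=
  mkOp (fun eta => exists zeta, forall xi, dom T xi -> ip (app T xi) eta = ip xi zeta)
       (fun eta => epsilon (inhabits (0 : H))
          (fun zeta => forall xi, dom T xi -> ip (app T xi) eta = ip xi zeta)).

Definition op_of_fun (f : H -> H) : op := mkOp (fun _ => True) f.

Definition inv_op (f : H -> H) : op :=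
  mkOp (fun y => exists x, f x = y)
       (fun y => epsilon (inhabits (0 : H)) (fun x => f x = y)).

Definition comp_op (A B : op) : op :=
  mkOp (fun x => dom B x /\ dom A (app B x)) (fun x => app A (app B x)).

Definition op_eq (A B : op) : Prop :=
  (forall x, dom A x <-> dom B x) /\ (forall x, dom A x -> app A x = app B x).

Definition bounded_linear (f : H -> H) : Prop :=
  (forall a x y, f (a *: x + y) = a *: f x + f y) /\
  exists M : C, forall x, hnorm (f x) <= M * hnorm x.

Definition selfadjoint_bounded (f : H -> H) : Prop :=
  bounded_linear f /\ forall x y, ip (f x) y = ip x (f y).

Definition bounded_metric (G : H -> H) : Prop :=
  selfadjoint_bounded G /\ forall x, x != 0 -> 0 < ip (G x) x.

Definition is_sqrt (G R : H -> H) : Prop :=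
  selfadjoint_bounded R /\ (forall x, 0 <= ip (R x) x) /\ (forall x, R (R x) = G x).

Definition conj_op (R : H -> H) (S : op) : op :=
  mkOp (fun xi => exists x, dom S x /\ xi = R x)
       (fun xi => R (app S (app (inv_op R) xi))).

End Hilbert.

(* Main.v *)
(* The adjoint formula is pure algebra: since R is self-adjoint and
   injective, <K (R x), eta> = <S x, R eta>, so eta is in D(K^* ) exactly
   when R eta is in D(S^* ) and S^* R eta lies in the range of R, and then
   R K^* eta = S^* R eta; uniqueness comes from the density of D(S).

   Density of D(K) = R D(S) reduces, R being bounded, to density of the
   range of R.  We prove the latter constructively by Richardson iteration:
   for the step T = I - c G with c = 1/(|R|^2 + 1), the iterates T^n y stay
   in y - ran R, form a Cauchy sequence (the numbers <T^j y, y> decrease to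
   their infimum) and their limit l satisfies G l = 0, hence l = 0. *)
Require Import Defs.
From mathcomp Require Import all_boot all_order all_algebra.
From Stdlib Require Import ClassicalEpsilon Classical.
From mathcomp Require Import ring.
Set Implicit Arguments. Unset Strict Implicit. Unset Printing Implicit Defensive.
Import Order.TTheory GRing.Theory Num.Theory.
Local Open Scope ring_scope.

Lemma ge0_small_eq0 (F : numFieldType) (K v : F) : 0 < K -> 0 <= v ->
  (forall d, 0 < d -> v <= K * d) -> v = 0.
Proof.
move=> K0 v0 small; have [//|vn0] := eqVneq v 0.
have vpos : 0 < v by rewrite lt_def vn0 v0.
have half : K * (v / (2 * K)) = v / 2.
  by rewrite [2 * K]mulrC invfM mulrCA mulVKf // lt0r_neq0.
have := small _ (divr_gt0 vpos (mulr_gt0 (ltr0n _ 2) K0)).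
rewrite half -(ler_pM2r (ltr0n F 2)) divfK ?pnatr_eq0 //.
by rewrite mulr_natr mulr2n gerDl (lt_geF vpos).
Qed.

Lemma ge0_seq_inf (C : numClosedFieldType) (a : nat -> C) :
  C_complete C -> (forall j, 0 <= a j) ->
  exists L, (forall j, L <= a j) /\ (forall e, 0 < e -> exists j, a j < L + e).
Proof.
move=> Ccomp a0.
have real : forall x, (exists j, x = - a j) -> x \is Num.real.
  by move=> x [j ->]; rewrite realN ger0_real.
have ub : exists M, forall x, (exists j, x = - a j) -> x <= M.
  by exists 0 => x [j ->]; rewrite oppr_le0.
have [s [s_ub s_least]] := Ccomp _ real (ex_intro _ (- a 0) (ex_intro _ 0%N erefl)) ub.
have s_real : s \is Num.real.
  by apply: ler0_real; apply: s_least => x [j ->]; rewrite oppr_le0.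
exists (- s); split=> [j|e e0]; first by rewrite lerNl; apply: s_ub; exists j.
apply: NNPP => far.
have : s <= s - e.
  apply: s_least => x [j ->].
  have : ~~ (a j < - s + e) by apply/negP => h; apply: far; exists j.
  rewrite real_ltNge ?negbK; first by rewrite lerNl opprB addrC.
    exact: ger0_real.
  by rewrite rpredD ?realN // gtr0_real.
by rewrite lerDl oppr_ge0 (lt_geF e0).
Qed.

Section InnerProduct.
Variables (C : numClosedFieldType) (H : lmodType C) (ip : H -> H -> C).
Hypothesis IP : inner_product ip.

Lemma ip0l z : ip 0 z = 0.
Proof.
have := ip_linl IP 1 0 0 z; rewrite scale1r addr0 mul1r => /eqP.
by rewrite -subr_eq subrr eq_sym => /eqP.
Qed.

Lemma ipDl x y z : ip (x + y) z = ip x z + ip y z.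
Proof. by have := ip_linl IP 1 x y z; rewrite scale1r mul1r. Qed.

Lemma ipZl a x z : ip (a *: x) z = a * ip x z.
Proof. by have := ip_linl IP a x 0 z; rewrite addr0 ip0l addr0. Qed.

Lemma ipBl x y z : ip (x - y) z = ip x z - ip y z.
Proof. by rewrite ipDl -scaleN1r ipZl mulN1r. Qed.

Lemma ipDr x y z : ip z (x + y) = ip z x + ip z y.
Proof. by rewrite !(ip_conj IP _ z) ipDl rmorphD. Qed.

Lemma ipZr a x z : ip z (a *: x) = a^* * ip z x.
Proof. by rewrite !(ip_conj IP _ z) ipZl rmorphM. Qed.

Lemma ipBr x y z : ip z (x - y) = ip z x - ip z y.
Proof. by rewrite !(ip_conj IP _ z) ipBl rmorphB. Qed.

Lemma sqnormB x y : ip (x - y) (x - y) = ip x x - ip x y - ip y x + ip y y.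
Proof. by rewrite ipBl !ipBr; ring. Qed.

Lemma sqnormBC u v : ip (u - v) (u - v) = ip (v - u) (v - u).
Proof. by rewrite !sqnormB; ring. Qed.

Lemma sqnormD_le x y : ip (x + y) (x + y) <= 2 * ip x x + 2 * ip y y.
Proof.
have -> : 2 * ip x x + 2 * ip y y = ip (x + y) (x + y) + ip (x - y) (x - y).
  by rewrite sqnormB ipDl !ipDr; ring.
by rewrite lerDl (ip_pos IP).
Qed.

Lemma hnorm_lt u e : 0 < e -> (hnorm ip u < e) = (ip u u < e ^+ 2).
Proof.
move=> e0; rewrite /hnorm -{1}(sqrCK (ltW e0)) ltr_sqrtC // ?qualifE /= ?(ip_pos IP) //.
exact: exprn_ge0 (ltW e0).
Qed.

Lemma denseP (D : H -> Prop) : dense ip D <->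
  (forall x e, 0 < e -> exists y, D y /\ ip (x - y) (x - y) < e).
Proof.
split=> [Ddense x e e0 | sq x e e0].
  have [y [Dy]] : exists y, D y /\ hnorm ip (x - y) < sqrtC e.
    by apply: Ddense; rewrite sqrtC_gt0.
  by rewrite hnorm_lt ?sqrtC_gt0 // sqrtCK; exists y.
have [y [Dy close]] := sq x _ (exprn_gt0 2 e0).
by exists y; rewrite hnorm_lt.
Qed.

Lemma dense_orth (D : H -> Prop) w : dense ip D -> (forall x, D x -> ip x w = 0) -> w = 0.
Proof.
move=> Ddense Dw; apply: NNPP => wn0.
have wpos : 0 < ip w w by rewrite lt_def (ip_pos IP) andbT; apply/eqP => /(ip_def IP).
have norm_pos : 0 < hnorm ip w by rewrite /hnorm sqrtC_gt0.
have [y [Dy]] := Ddense w _ norm_pos.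
rewrite hnorm_lt // /hnorm sqrtCK sqnormB (ip_conj IP y w) (Dw y Dy).
by rewrite conjC0 !subr0 gtrDl => /(le_lt_trans (ip_pos IP y)); rewrite ltxx.
Qed.

Lemma dense_uniq (D : H -> Prop) w1 w2 : dense ip D ->
  (forall x, D x -> ip x w1 = ip x w2) -> w1 = w2.
Proof.
move=> Ddense eq12; apply/eqP; rewrite -subr_eq0; apply/eqP.
by apply: (dense_orth Ddense) => x Dx; rewrite ipBr eq12 // subrr.
Qed.

End InnerProduct.

Section LinearMap.
Variables (F : nzRingType) (V : lmodType F) (f : V -> V).
Hypothesis f_lin : forall a x y, f (a *: x + y) = a *: f x + f y.

Lemma lin0 : f 0 = 0.
Proof.
have := f_lin 1 0 0; rewrite !scale1r addr0 => /eqP.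
by rewrite -subr_eq subrr eq_sym => /eqP.
Qed.

Lemma linD x y : f (x + y) = f x + f y.
Proof. by have := f_lin 1 x y; rewrite !scale1r. Qed.

Lemma linZ a x : f (a *: x) = a *: f x.
Proof. by have := f_lin a x 0; rewrite !addr0 lin0 addr0. Qed.

Lemma linB x y : f (x - y) = f x - f y.
Proof. by rewrite linD -scaleN1r linZ scaleN1r. Qed.

End LinearMap.

Section AdjointInverse.
Variables (C : numClosedFieldType) (H : lmodType C) (ip : H -> H -> C).

Lemma adjointP (T : op H) eta : dom (adjoint ip T) eta ->
  forall xi, dom T xi -> ip (app T xi) eta = ip xi (app (adjoint ip T) eta).
Proof.
move=> [zeta hzeta]; exact: (epsilon_spec (inhabits 0)
  (fun z => forall xi, dom T xi -> ip (app T xi) eta = ip xi z) (ex_intro _ zeta hzeta)).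
Qed.

Lemma inv_opK (f : H -> H) : injective f -> forall x, app (inv_op f) (f x) = x.
Proof.
move=> finj x; apply: finj.
exact: (epsilon_spec (inhabits 0) (fun x' => f x' = f x) (ex_intro _ x erefl)).
Qed.

End AdjointInverse.

Section ConjugateAdjoint.
Variables (C : numClosedFieldType) (H : lmodType C) (ip : H -> H -> C).
Hypothesis IP : inner_product ip.
Variables (R : H -> H) (S : op H).
Hypothesis R_sa : forall x y, ip (R x) y = ip x (R y).
Hypothesis R_inj : injective R.
Hypothesis S_dense : dense ip (dom S).

Let K := conj_op R S.

Lemma conj_app x : app K (R x) = R (app S x).
Proof. exact: (congr1 (fun z => R (app S z)) (inv_opK R_inj x)). Qed.

(* Testing against K is testing against S after moving R across. *)
Lemma conj_test eta zeta :
  (forall xi, dom K xi -> ip (app K xi) eta = ip xi zeta) <->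
  (forall x, dom S x -> ip (app S x) (R eta) = ip x (R zeta)).
Proof.
split=> [test x Sx | test xi [x [Sx ->]]]; last by rewrite conj_app !R_sa test.
by rewrite -!R_sa -conj_app; apply: test; exists x.
Qed.

Lemma conj_adjoint_dom eta : dom (adjoint ip K) eta ->
  dom (adjoint ip S) (R eta) /\
  R (app (adjoint ip K) eta) = app (adjoint ip S) (R eta).
Proof.
move=> Keta; have S_Reta : dom (adjoint ip S) (R eta).
  by exists (R (app (adjoint ip K) eta)); apply/conj_test/adjointP.
split=> //; apply: (dense_uniq IP S_dense) => x Sx.
by rewrite -(adjointP S_Reta) //; apply/esym; apply: (proj1 (conj_test _ _) (adjointP Keta)).
Qed.

Lemma conj_op_adjoint :
  op_eq (adjoint ip K) (comp_op (inv_op R) (comp_op (adjoint ip S) (op_of_fun R))).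
Proof.
split=> [eta|eta Keta]; last first.
  by have [_ RK] := conj_adjoint_dom Keta; rewrite -(inv_opK R_inj (app _ eta)) RK.
split=> [Keta | [[_ S_Reta] [x Rx]]].
  have [S_Reta RK] := conj_adjoint_dom Keta.
  by split=> //; exists (app (adjoint ip K) eta).
by exists x; apply/conj_test => y Sy; rewrite Rx -(adjointP S_Reta).
Qed.

End ConjugateAdjoint.

Section RangeDense.
Variables (C : numClosedFieldType) (H : lmodType C) (ip : H -> H -> C).
Hypothesis IP : inner_product ip.
Hypothesis C_comp : C_complete C.
Hypothesis H_comp : complete ip.
Variables (R : H -> H) (B : C).
Hypothesis R_lin : forall a x y, R (a *: x + y) = a *: R x + R y.
Hypothesis R_sa : forall x y, ip (R x) y = ip x (R y).
Hypothesis G_pos : forall x, x != 0 -> 0 < ip (R (R x)) x.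
Hypothesis B_ge0 : 0 <= B.
Hypothesis R_bound : forall x, ip (R x) (R x) <= B * ip x x.

(* The Richardson step T = I - c G for G = R^2, with c = 1/(B+1) so that
   c G <= I; T is self-adjoint, commutes with R and is positive. *)
Let c : C := (B + 1)^-1.
Let step (x : H) : H := x - c *: R (R x).

Lemma B1_gt0 : 0 < B + 1.
Proof. by apply: (le_lt_trans B_ge0); rewrite ltrDl ltr01. Qed.

Lemma c_gt0 : 0 < c.
Proof. by rewrite invr_gt0 B1_gt0. Qed.

Lemma RR_step u : R (R u) = (B + 1) *: (u - step u).
Proof.
rewrite /step opprB addrCA subrr addr0 scalerA mulrV ?scale1r //.
exact: unitf_gt0 B1_gt0.
Qed.

Lemma step_sa u v : ip (step u) v = ip u (step v).
Proof. by rewrite (ipBl IP) (ipBr IP) (ipZl IP) (ipZr IP) (geC0_conj (ltW c_gt0)) !R_sa. Qed.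

Lemma iter_step_sa k u v : ip (iter k step u) v = ip u (iter k step v).
Proof. by elim: k u v => //= k IH u v; rewrite step_sa IH -iterSr. Qed.

Lemma iter_step_R k x : iter k step (R x) = R (iter k step x).
Proof. by elim: k => //= k ->; rewrite /step (linB R_lin) (linZ R_lin). Qed.

Lemma step_pos w : 0 <= ip (step w) w.
Proof.
rewrite (ipBl IP) (ipZl IP) R_sa subr_ge0.
apply: (le_trans (ler_wpM2l (ltW c_gt0) (R_bound w))).
rewrite mulrA -{2}(mul1r (ip w w)); apply: ler_wpM2r; first exact: ip_pos IP w.
by rewrite mulrC ler_pdivrMr ?B1_gt0 // mul1r lerDl ler01.
Qed.

(* Every power of the step is positive: split it in two halves. *)
Lemma iter_step_pos j v : 0 <= ip (iter j step v) v.
Proof.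
rewrite -[j](odd_double_half) -addnn; case: (odd j).
  by rewrite add1n iterS iterD -iterS iterSr iter_step_sa step_pos.
by rewrite add0n iterD iter_step_sa (ip_pos IP).
Qed.

Lemma RR_bound w : ip (R (R w)) (R (R w)) <= B ^+ 2 * ip w w.
Proof. by apply: le_trans (R_bound _) _; rewrite expr2 -mulrA; apply: ler_wpM2l. Qed.

Section Orbit.
Variable y : H.

(* a j = <T^j y, y> decreases to its infimum, so the orbit is Cauchy. *)
Let a j := ip (iter j step y) y.

Lemma orbit_decr n m : (n <= m)%N -> a m <= a n.
Proof.
elim: m => [|m IH]; first by rewrite leqn0 => /eqP ->.
rewrite leq_eqVlt => /orP [/eqP -> //|]; rewrite ltnS => /IH; apply: le_trans.
rewrite /a iterS {1}/step (ipBl IP) (ipZl IP) R_sa -iter_step_R.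
by rewrite gerDl oppr_le0; apply: mulr_ge0 (ltW c_gt0) (iter_step_pos _ _).
Qed.

Lemma orbit_dist k m : (k <= m)%N ->
  ip (iter k step y - iter m step y) (iter k step y - iter m step y)
    <= a (k + k) - a (m + m).
Proof.
move=> km; rewrite (sqnormB IP) -!iter_step_sa -!iterD.
have hm : a (m + m) <= a (m + k) by apply: orbit_decr; rewrite leq_add2l.
rewrite -subr_ge0 (_ : _ - _ = (a (m + k) - a (m + m)) *+ 2); last first.
  by rewrite /a (addnC k m); ring.
by apply: mulrn_wge0; rewrite subr_ge0.
Qed.

Lemma orbit_cauchy : cauchy ip (fun n => iter n step y).
Proof.
have [L [L_lb L_inf]] := ge0_seq_inf C_comp (fun j => iter_step_pos j y).
move=> e e0; have [j close] := L_inf _ (exprn_gt0 2 e0).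
exists j => n m jn jm; rewrite hnorm_lt //.
wlog nm : n m jn jm / (n <= m)%N.
  move=> W; case: (leqP n m) => [|/ltnW] h; first exact: W.
  by rewrite (sqnormBC IP); apply: W.
apply: le_lt_trans (orbit_dist nm) (le_lt_trans _ (_ : a j - L < e ^+ 2)).
  by apply: lerB (L_lb _); apply: orbit_decr; apply: leq_trans jn (leq_addr _ _).
by rewrite ltrBlDl.
Qed.

(* A limit l of the orbit has |G l|^2 <= Kc d for every d > 0, because
   G l = G (l - u) + (B + 1) (u - T u) with u = T^N y close to l. *)
Let Kc := 2 * B ^+ 2 + 8 * (B + 1) ^+ 2.

Lemma orbit_limit_G l : converges ip (fun n => iter n step y) l ->
  forall d, 0 < d -> ip (R (R l)) (R (R l)) <= Kc * d.
Proof.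
move=> conv d d0.
have [N close] : exists N, forall n, (N <= n)%N -> hnorm ip (iter n step y - l) < sqrtC d.
  by apply: conv; rewrite sqrtC_gt0.
have {}close n : (N <= n)%N -> ip (l - iter n step y) (l - iter n step y) < d.
  by move/close; rewrite hnorm_lt ?sqrtC_gt0 // sqrtCK (sqnormBC IP).
have := close _ (leqnn N); have := close _ (leqnSn N).
rewrite iterS; set u := iter N step y => close_Tu close_u.
have -> : R (R l) = R (R (l - u)) + (B + 1) *: ((u - l) + (l - step u)).
  by rewrite addrA subrK -RR_step !(linB R_lin) subrK.
apply: le_trans (sqnormD_le IP _ _) _.
have scaled w : ip ((B + 1) *: w) ((B + 1) *: w) = (B + 1) ^+ 2 * ip w w.
  by rewrite (ipZl IP) (ipZr IP) (geC0_conj (ltW B1_gt0)) mulrA -expr2.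
rewrite scaled.
have far_u : ip (R (R (l - u))) (R (R (l - u))) <= B ^+ 2 * d.
  by apply: le_trans (RR_bound _) (ler_wpM2l (exprn_ge0 2 B_ge0) (ltW close_u)).
have two_ge0 : 0 <= 2 :> C by rewrite ler0n.
have step_close : ip ((u - l) + (l - step u)) ((u - l) + (l - step u)) <= 4 * d.
  apply: le_trans (sqnormD_le IP _ _) _; rewrite (sqnormBC IP).
  have -> : 4 * d = 2 * d + 2 * d by ring.
  exact: lerD (ler_wpM2l two_ge0 (ltW close_u)) (ler_wpM2l two_ge0 (ltW close_Tu)).
have B1sq_ge0 : 0 <= (B + 1) ^+ 2 := exprn_ge0 2 (ltW B1_gt0).
apply: le_trans (lerD (ler_wpM2l two_ge0 far_u)
  (ler_wpM2l two_ge0 (ler_wpM2l B1sq_ge0 step_close))) _.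
suff -> : Kc * d = 2 * (B ^+ 2 * d) + 2 * ((B + 1) ^+ 2 * (4 * d)) by [].
by rewrite /Kc; ring.
Qed.

Lemma orbit_limit_zero l : converges ip (fun n => iter n step y) l -> l = 0.
Proof.
move=> conv.
have Kc_gt0 : 0 < Kc.
  apply: ltr_wpDl (mulr_ge0 (ler0n _ 2) (exprn_ge0 2 B_ge0)) _.
  exact: mulr_gt0 (ltr0Sn _ 7) (exprn_gt0 2 B1_gt0).
have GGl := ge0_small_eq0 Kc_gt0 (ip_pos IP _) (orbit_limit_G conv).
by apply: NNPP => /eqP /G_pos; rewrite (ip_def IP GGl) (ip0l IP) ltxx.
Qed.

(* The orbit stays in y - ran R and tends to 0, so y is a limit of ran R. *)
Lemma orbit_range n : exists x, iter n step y = y - R x.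
Proof.
elim: n => [|n [x IH]]; first by exists 0; rewrite (lin0 R_lin) subr0.
exists (x + c *: R (y - R x)).
by rewrite iterS IH /step (linD R_lin x) (linZ R_lin) opprD addrA.
Qed.

Lemma range_close e : 0 < e -> exists x, ip (y - R x) (y - R x) < e.
Proof.
move=> e0; have [l conv] := H_comp orbit_cauchy.
have [N close] : exists N, forall n, (N <= n)%N -> hnorm ip (iter n step y - l) < sqrtC e.
  by apply: conv; rewrite sqrtC_gt0.
have [x eqN] := orbit_range N; exists x.
move: (close N (leqnn N)); rewrite hnorm_lt ?sqrtC_gt0 // sqrtCK.
by rewrite (orbit_limit_zero conv) subr0 eqN.
Qed.

End Orbit.

Lemma range_dense : dense ip (fun z => exists x, z = R x).
Proof.
apply/(denseP IP) => y e e0; have [x close] := range_close y e0.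
by exists (R x); split=> //; exists x.
Qed.

End RangeDense.

Section BoundedImage.
Variables (C : numClosedFieldType) (H : lmodType C) (ip : H -> H -> C).
Hypothesis IP : inner_product ip.
Variables (f : H -> H) (B : C).
Hypothesis f_lin : forall a x y, f (a *: x + y) = a *: f x + f y.
Hypothesis B_ge0 : 0 <= B.
Hypothesis f_bound : forall x, ip (f x) (f x) <= B * ip x x.

Lemma image_dense (D : H -> Prop) :
  dense ip (fun z => exists x, z = f x) -> dense ip D ->
  dense ip (fun z => exists x, D x /\ z = f x).
Proof.
move=> range_dense D_dense; apply/(denseP IP) => x e e0.
have d0 : 0 < e / 4 by rewrite divr_gt0 ?ltr0n.
have B1_gt0 : 0 < B + 1 by apply: le_lt_trans B_ge0 _; rewrite ltrDl ltr01.
have [_ [[z ->] close_z]] := proj1 (denseP IP _) range_dense x _ d0.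
have [s [Ds close_s]] := proj1 (denseP IP _) D_dense z _ (divr_gt0 d0 B1_gt0).
exists (f s); split; first by exists s.
have f_close : ip (f (z - s)) (f (z - s)) < e / 4.
  apply: le_lt_trans (f_bound _) (le_lt_trans (_ : _ <= (B + 1) * _) _).
    by apply: ler_wpM2r; rewrite ?(ip_pos IP) // lerDl ler01.
  by rewrite mulrC -ltr_pdivlMr.
rewrite (_ : x - f s = (x - f z) + f (z - s)); last by rewrite (linB f_lin) addrA subrK.
apply: le_lt_trans (sqnormD_le IP _ _) _.
have -> : e = 2 * (e / 4) + 2 * (e / 4) by field.
by apply: ltrD; rewrite ltr_pM2l ?ltr0n.
Qed.

End BoundedImage.

Section MetricSquareRoot.
Variables (C : numClosedFieldType) (H : lmodType C) (ip : H -> H -> C).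
Hypothesis IP : inner_product ip.

Lemma sqnorm_bound (f : H -> H) (M : C) :
  (forall x, hnorm ip (f x) <= M * hnorm ip x) ->
  forall x, ip (f x) (f x) <= `|M| ^+ 2 * ip x x.
Proof.
move=> f_bd x; have fx_ge0 : 0 <= hnorm ip (f x) by rewrite sqrtC_ge0 (ip_pos IP).
have x_ge0 : 0 <= hnorm ip x by rewrite sqrtC_ge0 (ip_pos IP).
have Mx_ge0 := le_trans fx_ge0 (f_bd x).
have := lerXn2r 2 fx_ge0 Mx_ge0 (f_bd x).
by rewrite -(ger0_norm Mx_ge0) normrM (ger0_norm x_ge0) exprMn /hnorm !sqrtCK.
Qed.

Lemma sqrt_metric_inj (R : H -> H) :
  (forall a x y, R (a *: x + y) = a *: R x + R y) ->
  (forall x, x != 0 -> 0 < ip (R (R x)) x) -> injective R.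
Proof.
move=> R_lin G_pos x1 x2 eqR; apply/eqP; rewrite -subr_eq0; apply/negPn/negP.
by move/G_pos; rewrite !(linB R_lin) eqR subrr (ip0l IP) ltxx.
Qed.

End MetricSquareRoot.

Theorem lemma3p5 (C : numClosedFieldType) (H : lmodType C) (ip : H -> H -> C)
  (Hhil : hilbert ip)
  (G R : H -> H) (HG : bounded_metric ip G) (HR : is_sqrt ip G R)
  (S : op H) (HSlin : linear_op S) (HSdense : densely_defined ip S)
  (HSclosed : closed_op ip S) :
  densely_defined ip (conj_op R S) /\
  op_eq (adjoint ip (conj_op R S))
        (comp_op (inv_op R) (comp_op (adjoint ip S) (op_of_fun R))).
Proof.
case: Hhil => C_comp [IP H_comp].
case: HR => [[[R_lin [M R_bd]] R_sa] [_ RR_G]].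
have G_pos x : x != 0 -> 0 < ip (R (R x)) x by rewrite RR_G; apply: HG.2.
have R_bound := sqnorm_bound IP R_bd.
have B_ge0 : 0 <= `|M| ^+ 2 by rewrite exprn_ge0.
split.
  apply: (image_dense IP R_lin B_ge0 R_bound _ HSdense).
  exact: (range_dense IP C_comp H_comp R_lin R_sa G_pos B_ge0 R_bound).
exact: (conj_op_adjoint IP R_sa (sqrt_metric_inj IP R_lin G_pos) HSdense).
Qed.
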